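(* No multi-orientable three-dimensional GFT graph contains a tadface, i.e. a face that passes at least twice through the same edge.
   Context: A three-dimensional (orientable) GFT graph is a graph with 4-valent vertices in which every edge consists of three parallel strands (left, middle, right), joined without twists. At each vertex the four half-edges are cyclically ordered, and strands are joined inside the vertex following the Boulatov vertex $\phi(g_1,g_2,g_3)\phi(g_3,g_4,g_5)\phi(g_5,g_2,g_6)\phi(g_6,g_4,g_1)$: each pair of distinct half-edges at a vertex shares exactly one strand; the middle strand of a half-edge connects to the cyclically opposite half-edge and the two outer strands connect to the two cyclically adjacent half-edges. The graph may have external legs. A face is a maximal path formed by concatenated strands (closed, or ending at external legs). A tadface is a face going at least twice through an edge (through two different strands of that edge). A GFT graph is multi-orientable if each half-edge can be labeled $+$ or $-$ so that at every vertex there are two $+$ and two $-$ half-edges alternating in the cyclic order ($+,-,+,-$), and every edge joins a $-$ half-edge to a $+$ half-edge. *)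

(* Defs.v *)
From HB Require Import structures.
From mathcomp Require Import all_boot.

Set Implicit Arguments.
Unset Strict Implicit.
Unset Printing Implicit Defensive.

(* Position of a strand within a half-edge, as seen from the vertex carrying  *)
(* that half-edge: the first, second and third argument of the field phi in   *)
(* the Boulatov vertex.                                                       *)
Inductive position := Left | Middle | Right.

Definition position_code (p : position) : option bool :=
  match p with Left => Some false | Middle => None | Right => Some true end.

Definition position_decode (c : option bool) : position :=
  match c with Some false => Left | None => Middle | Some true => Right end.

Lemma position_codeK : cancel position_code position_decode.
Proof. by case. Qed.

HB.instance Definition _ := Finite.copy position (can_type position_codeK).

(* The half-edges at the vertex v are (v, i) for i : 'I_4, in the cyclic      *)
(* order i, ordS i, ...  The fixed points of join are the external legs; the  *)
(* edges are the pairs {h, join h} with join h != h.                          *)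
Record gft_graph := GFTGraph {
  vertex : finType;
  join : vertex * 'I_4 -> vertex * 'I_4;
  joinK : involutive join
}.

Section GFTGraph.

Variable G : gft_graph.

Definition half_edge : finType := (vertex G * 'I_4)%type.

Definition internal (h : half_edge) : bool := join h != h.

Definition edge_of (h : half_edge) : {set half_edge} := [set h; join h].

Definition strand_end : finType := (half_edge * position)%type.

(* phi(g1,g2,g3) phi(g3,g4,g5) phi(g5,g2,g6) phi(g6,g4,g1): the third         *)
(* argument of each field is the first argument of the cyclically next one,   *)
(* and the second arguments of opposite fields coincide.                      *)
Definition through_vertex (x : strand_end) : strand_end :=
  let: ((v, i), p) := x in
  match p with
  | Left => ((v, ord_pred i), Right)
  | Middle => ((v, ordS (ordS i)), Middle)
  | Right => ((v, ordS i), Left)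
  end.

(* Both ends of an edge are seen from their own vertex, hence parallel        *)
(* untwisted strands lead from the left of one half-edge to the right of the  *)
(* other. Only meaningful when x.1 is internal.                               *)
Definition along_edge (x : strand_end) : strand_end :=
  let: (h, p) := x in
  (join h, match p with Left => Right | Middle => Middle | Right => Left end).

Definition edge_strand (x : strand_end) : {set strand_end} :=
  [set x; along_edge x].

(* A path is recorded by the strand ends at which it enters the successive    *)
(* vertices it goes through: entering at x, it leaves at through_vertex x     *)
(* and, if this end belongs to an edge, enters the next vertex at its image   *)
(* under along_edge.                                                          *)
Definition concatenated : rel strand_end := fun x y =>
  internal (through_vertex x).1 && (y == along_edge (through_vertex x)).

Definition closed_face (F : seq strand_end) : bool :=
  [&& F != [::], uniq F & cycle concatenated F].

Definition open_face (F : seq strand_end) : bool :=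
  if F is x :: s then
    [&& ~~ internal x.1, path concatenated x s
      & ~~ internal (through_vertex (last x s)).1]
  else false.

Definition face (F : seq strand_end) : bool := closed_face F || open_face F.

(* S is a strand of the edge of h along which F leaves one of its vertices.   *)
Definition goes_through (F : seq strand_end) (h : half_edge)
    (S : {set strand_end}) : Prop :=
  exists x, [/\ x \in F, internal (through_vertex x).1,
    edge_of (through_vertex x).1 = edge_of h
    & edge_strand (through_vertex x) = S].

Definition tadface (F : seq strand_end) : Prop :=
  face F /\
  exists h S T,
    [/\ internal h, S <> T, goes_through F h S & goes_through F h T].

Definition multi_orientable : Prop :=
  exists plus : half_edge -> bool,
    (forall v i, plus (v, ordS i) = ~~ plus (v, i)) /\
    (forall h, internal h -> plus (join h) = ~~ plus h).

Lemma through_vertexK : involutive through_vertex.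
Proof.
case=> -[v i] [] /=; rewrite ?ordSK ?ord_predK //.
by congr (_, _, _); apply: val_inj; case: i => -[|[|[|[|]]]].
Qed.

Lemma along_edgeK : involutive along_edge.
Proof. by case=> h []; rewrite /= joinK. Qed.

Lemma one_strand_per_pair v (i j : 'I_4) :
  i != j -> exists! p, (through_vertex ((v, i), p)).1 = (v, j).
Proof.
move=> ne; have: exists p, (through_vertex ((v, i), p)).1 = (v, j)
    /\ forall q, (through_vertex ((v, i), q)).1 = (v, j) -> p = q; last first.
  by case=> p [? ?]; exists p.
suff [p Hp]: exists p, forall q,
    ((through_vertex ((v, i), q)).1 == (v, j)) = (p == q).
  by exists p; split; [apply/eqP; rewrite Hp | move=> q /eqP; rewrite Hp => /eqP].
case: i ne => -[|[|[|[|//]]]] Hi; case: j => -[|[|[|[|//]]]] Hj //= _;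
  (by exists Left; case; rewrite /= xpair_eqE eqxx)
  || (by exists Middle; case; rewrite /= xpair_eqE eqxx)
  || by exists Right; case; rewrite /= xpair_eqE eqxx.
Qed.

End GFTGraph.

(* Main.v *)
Require Import Defs.
From mathcomp Require Import all_boot.

(** Orient every face. Crossing a vertex and then an edge preserves the position
    at which the face enters a vertex, and for an outer strand it flips the sign
    of the half-edge twice. Hence a face either runs through middle strands only,
    of which every edge has just one, or always leaves its vertices at the same
    outer position through half-edges of the same sign. In the latter case it
    uses each edge only from the end carrying that sign, hence only through one
    strand. *)

Lemma path_invariant (T : eqType) (U : Type) (e : rel T) (f : T -> U) x s :
  (forall y z, e y z -> f z = f y) -> path e x s ->
  {in x :: s, forall y, f y = f x}.
Proof.
move=> fE; elim: s x => [|z s IHs] x /=; first by move=> _ y /[!inE] /eqP ->.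
case/andP=> /fE fz /IHs fs y; rewrite inE => /predU1P[-> //|/fs ->].
exact: fz.
Qed.

Section Orientation.

Variables (G : gft_graph) (plus : half_edge G -> bool).
Hypothesis plus_ordS : forall v i, plus (v, ordS i) = ~~ plus (v, i).
Hypothesis plus_join : forall h, internal h -> plus (join h) = ~~ plus h.

(** The sign is masked at [Middle], where it alternates along a face: opposite half-edges have equal
    signs and the edge flips once. *)
Definition outer_sign (x : strand_end G) : position * bool :=
  (x.2, (x.2 != Middle) && plus x.1).

Lemma plus_ord_pred v i : plus (v, ord_pred i) = ~~ plus (v, i).
Proof. by rewrite -{2}[i]ord_predK plus_ordS negbK. Qed.

(** Faces list entering ends, but edges are recorded at leaving ends; this passes from one to the
    other. *)
Lemma outer_sign_through_vertex x y :
  outer_sign x = outer_sign y ->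
  outer_sign (through_vertex x) = outer_sign (through_vertex y).
Proof.
case: x y => [[v i] p] [[w j] q] [<-{q}].
by case: p => //= E; rewrite /outer_sign /= ?plus_ordS ?plus_ord_pred E.
Qed.

Lemma concatenated_outer_sign x y :
  concatenated x y -> outer_sign y = outer_sign x.
Proof.
case: x => [[v i] p] /andP[int_x /eqP->]; rewrite /outer_sign.
case: p int_x => //= /plus_join ->.
- by rewrite plus_ord_pred negbK.
- by rewrite plus_ordS negbK.
Qed.

Lemma face_outer_sign F :
  face F -> {in F &, forall x y, outer_sign x = outer_sign y}.
Proof.
case: F => [|z s] //= faceF.
have const_zs: {in z :: s, forall x, outer_sign x = outer_sign z}.
  case/orP: faceF => [/and3P[_ _ /= zs]|/and3P[_ zs _]].
    move=> x zs_x; apply: (path_invariant _ _ _ _ _ _ concatenated_outer_sign zs).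
    by rewrite -rcons_cons mem_rcons inE zs_x orbT.
  exact: path_invariant concatenated_outer_sign zs.
by move=> x y /const_zs -> /const_zs ->.
Qed.

Lemma edge_strand_outer_sign (a b : strand_end G) :
  internal b.1 -> edge_of a.1 = edge_of b.1 -> outer_sign a = outer_sign b ->
  edge_strand a = edge_strand b.
Proof.
case: a b => [h p] [k q] /= int_k eq_hk [<-{q}] sign_hk.
have: h \in edge_of k by rewrite -eq_hk set21.
rewrite !inE => /predU1P[-> //|/eqP def_h]; rewrite {h eq_hk}def_h in sign_hk *.
(* Opposite ends of an edge differ in sign, so only [Middle] survives, whose strand is the same from
   both ends. *)
case: p sign_hk => /=; rewrite ?plus_join //; try by case: plus.
by rewrite /edge_strand /= joinK setUC.
Qed.

End Orientation.

Theorem theorem3p1 (G : gft_graph) :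
  multi_orientable G -> ~ (exists F : seq (strand_end G), tadface F).
Proof.
move=> [plus [plusS plusJ]] [F [faceF [h [S [T [_ neST]]]]]].
case=> x [Fx _ eq_xh defS] [y [Fy int_y eq_yh defT]]; apply: neST.
rewrite -defS -defT.
apply: (edge_strand_outer_sign _ _ plusJ) => //; first by rewrite eq_xh eq_yh.
apply: (outer_sign_through_vertex _ _ plusS).
exact: (face_outer_sign _ _ plusS plusJ _ faceF).
Qed.
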